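(* Let $A_0,\dots,A_n\in\mathfrak J$ and let $\alpha_0,\dots,\alpha_n\in[0,1]$ with $\sum_{i=0}^n\alpha_i=1$. Then the partition average has the following properties. 1. $\bigotimes_{i=0}^n\alpha_iA_i\in\mathfrak J$. 2. For any permutation $r$ of $\{0,\dots,n\}$, $\bigotimes_{i=0}^n\alpha_iA_i=\bigotimes_{i=0}^n\alpha_{r(i)}A_{r(i)}$. 3. If for some $k\in\{1,\dots,n\}$, $A_k=A_{k+1}=\dots=A_n$, then $\bigotimes_{i=0}^n\alpha_iA_i=\bigotimes_{i=0}^k\beta_iA_i$ with $\beta_i=\alpha_i$ for $i=0,\dots,k-1$ and $\beta_k=\sum_{i=k}^n\alpha_i$. In particular, for $A\in\mathfrak J$, $\bigotimes_{i=0}^n\alpha_iA=A$. 4. $\operatorname{ci}\Big(\bigcap_{\{i:\alpha_i>0\}}A_i\Big)\subseteq\bigotimes_{i=0}^n\alpha_iA_i\subseteq\bigcup_{\{i:\alpha_i>0\}}A_i$. 5. If $\alpha_j=1$ for some $j$, then $\bigotimes_{i=0}^n\alpha_iA_i=A_j$. 6. $\mu\Big(\bigotimes_{i=0}^n\alpha_iA_i\Big)=\sum_{i=0}^n\alpha_i\,\mu(A_i)$.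
   Context: Fix $m\ge1$ and let $\mu$ be Lebesgue measure on $\mathbb R^m$. $\mathbb J$ denotes the collection of Jordan measurable subsets of $\mathbb R^m$ (bounded sets whose boundary has Lebesgue measure zero). $\operatorname{ci}(A)$ is the closure of the interior of $A$; a bounded set $A$ is regular compact if $A=\operatorname{ci}(A)$. $\mathfrak J\subset\mathbb J$ is the collection of regular compact sets in $\mathbb J$ (including $\emptyset$). A subset-generating function is a map $\Psi:\mathbb J\times[0,1]\to\mathfrak J$ such that for all $A\in\mathbb J$ and $s,t\in[0,1]$: (1) $\Psi(A,t)\subseteq A$ up to a null set, i.e. $\mu(\Psi(A,t)\setminus A)=0$; (2) $\mu(\Psi(A,t))=t\,\mu(A)$; (3) $\Psi(A,s)\subseteq\Psi(A,t)$ if $s\le t$. A subset-generating function $\Psi$ is fixed. For $A_0,\dots,A_n\in\mathfrak J$ and nonempty $\chi\subseteq\{0,\dots,n\}$ put $\Omega_\chi=\big(\bigcap_{k\in\chi}A_k\big)\setminus\big(\bigcup_{l\in\{0,\dots,n\}\setminus\chi}A_l\big)$, and $\Omega_\emptyset=\emptyset$. For weights $\alpha_i\in[0,1]$ with $\sum_i\alpha_i=1$, the partition average is $\bigotimes_{i=0}^n\alpha_iA_i:=\bigcup_{\chi\subseteq\{0,\dots,n\}}\Psi\big(\Omega_\chi,\sum_{k\in\chi}\alpha_k\big)$. *)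

(* Defs.v *)
From HB Require Import structures.
From mathcomp Require Import all_boot all_order all_algebra perm.
From mathcomp Require Import all_classical all_reals all_analysis.

Set Implicit Arguments.
Unset Strict Implicit.
Unset Printing Implicit Defensive.
Import Order.TTheory GRing.Theory Num.Theory.
Import numFieldNormedType.Exports.
Local Open Scope classical_set_scope.
Local Open Scope ring_scope.

(* A half-open box prod_i ]a_i, b_i] of R^m is encoded by the pair (a, b). *)
Definition box (R : realType) (m : nat) (ab : 'rV[R]_m * 'rV[R]_m) :
    set 'rV[R]_m :=
  [set x | forall i, ab.1 ord0 i < x ord0 i <= ab.2 ord0 i].

Definition box_volume (R : realType) (m : nat) (ab : 'rV[R]_m * 'rV[R]_m) : R :=
  \prod_(i < m) (ab.2 ord0 i - ab.1 ord0 i).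

Definition box_cover (R : realType) (m : nat) (A : set 'rV[R]_m) :
    set (nat -> 'rV[R]_m * 'rV[R]_m) :=
  [set B : nat -> 'rV[R]_m * 'rV[R]_m |
    (forall k i, (B k).1 ord0 i <= (B k).2 ord0 i) /\
    A `<=` \bigcup_k box (B k)].

(* Lebesgue measure on R^m.  As with mu_ext and completed_lebesgue_measure,
   the underlying set function is total: it is the Lebesgue outer measure,
   which is Lebesgue measure on the Lebesgue measurable sets, hence on all
   Jordan measurable ones (these need not be Borel sets). *)
Definition lebesgue_rV (R : realType) (m : nat) (A : set 'rV[R]_m) : \bar R :=
  ereal_inf
    [set (\sum_(0 <= k <oo) (box_volume (B k))%:E)%E | B in box_cover A].

Definition boundary (T : topologicalType) (A : set T) : set T :=
  closure A `\` A°.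

Definition ci (T : topologicalType) (A : set T) : set T := closure A°.

Definition jordan_measurable (R : realType) (m : nat) (A : set 'rV[R]_m) :
    Prop :=
  bounded_set A /\ lebesgue_rV (boundary A) = 0%E.

Definition regular_compact (R : realType) (m : nat) (A : set 'rV[R]_m) : Prop :=
  bounded_set A /\ A = ci A.

Definition regular_jordan (R : realType) (m : nat) (A : set 'rV[R]_m) : Prop :=
  regular_compact A /\ jordan_measurable A.

(* Psi is a total function on all sets and all reals; only its values at
   Jordan measurable sets and parameters in [0, 1] are constrained. *)
Record subset_generating (R : realType) (m : nat)
    (Psi : set 'rV[R]_m -> R -> set 'rV[R]_m) : Prop := SubsetGenerating {
  sg_regular_jordan : forall A t, jordan_measurable A -> 0 <= t <= 1 ->
    regular_jordan (Psi A t);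
  sg_sub_null : forall A t, jordan_measurable A -> 0 <= t <= 1 ->
    lebesgue_rV (Psi A t `\` A) = 0%E;
  sg_measure : forall A t, jordan_measurable A -> 0 <= t <= 1 ->
    lebesgue_rV (Psi A t) = (t%:E * lebesgue_rV A)%E;
  sg_monotone : forall A s t, jordan_measurable A ->
    0 <= s <= 1 -> 0 <= t <= 1 -> s <= t -> Psi A s `<=` Psi A t
}.

Definition partition_cell (T : Type) (n : nat) (A : 'I_n.+1 -> set T)
    (X : {set 'I_n.+1}) : set T :=
  if X == finset.set0 then set0
  else (\bigcap_(k in [set k | k \in X]) A k) `\`
       (\bigcup_(l in [set l | l \notin X]) A l).

Definition partition_average (R : realType) (m : nat)
    (Psi : set 'rV[R]_m -> R -> set 'rV[R]_m)
    (n : nat) (alpha : 'I_n.+1 -> R) (A : 'I_n.+1 -> set 'rV[R]_m) :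
    set 'rV[R]_m :=
  \bigcup_(X : {set 'I_n.+1})
    Psi (partition_cell A X) (\sum_(k < n.+1 | k \in X) alpha k).

(* Main.v *)
(* A regular compact set P that lies in a closed set F up to a null set lies in
   F: the open set P° \ F is null, hence empty, and P is the closure of P°.
   Every inclusion of the theorem reduces to this fact.  It needs that nonempty
   open sets are not null: a cover of a box by boxes is integrated one
   coordinate at a time with one-dimensional Lebesgue measure, so that no
   product measure is required.  The additivity in the measure formula comes
   from Caratheodory's theorem: half-spaces are Caratheodory measurable because
   a hyperplane cuts each box of a cover into two boxes, hence so are boxes,
   open sets and, adding a null part of the boundary, Jordan sets. *)

Require Import Defs.
From HB Require Import structures.
From mathcomp Require Import all_boot all_order all_algebra perm.
From mathcomp Require Import all_classical all_reals all_analysis.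
From mathcomp Require Import measurable_realfun.
Set Implicit Arguments.
Unset Strict Implicit.
Unset Printing Implicit Defensive.
Import Order.TTheory GRing.Theory Num.Theory.
Import numFieldNormedType.Exports.
Local Open Scope classical_set_scope.
Local Open Scope ring_scope.

(** * Lebesgue outer measure *)

Definition box_ordered (R : realType) (m : nat) (ab : 'rV[R]_m * 'rV[R]_m) :
    Prop :=
  forall i, ab.1 ord0 i <= ab.2 ord0 i.

Lemma box_volume_ge0 (R : realType) (m : nat) (ab : 'rV[R]_m * 'rV[R]_m) :
  box_ordered ab -> 0 <= box_volume ab.
Proof. by move=> ab_le; apply: prodr_ge0 => i _; rewrite subr_ge0. Qed.

Definition rV_set (R : realType) (m : nat) (x : 'rV[R]_m) (j : 'I_m) (t : R) :
    'rV[R]_m :=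
  \row_i (if i == j then t else x ord0 i).

Lemma rV_setE (R : realType) (m : nat) (x : 'rV[R]_m) (j : 'I_m) (t : R)
    (i : 'I_m) :
  rV_set x j t ord0 i = if i == j then t else x ord0 i.
Proof. by rewrite mxE. Qed.

(** * Volume of a box against the total volume of a cover *)

Section box_cover_volume.
Context (R : realType) (m : nat).
Variables (Q : 'rV[R]_m * 'rV[R]_m) (B : nat -> 'rV[R]_m * 'rV[R]_m).
Hypothesis Q_lt : forall i, Q.1 ord0 i < Q.2 ord0 i.
Hypothesis B_cover : box_cover (box Q) B.

Let side (ab : 'rV[R]_m * 'rV[R]_m) (i : 'I_m) : set R :=
  `]ab.1 ord0 i, ab.2 ord0 i]%classic.

Let width (ab : 'rV[R]_m * 'rV[R]_m) (i : 'I_m) : R :=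
  ab.2 ord0 i - ab.1 ord0 i.

(** Factor [i] at stage [j], when the coordinates below [j] are integrated out. The product over [i]
    is the indicator of [box ab] at [x] for [j = 0] and the volume of [ab] for [j = m]. *)
Let partial (ab : 'rV[R]_m * 'rV[R]_m) (j : nat) (x : 'rV[R]_m) (i : 'I_m) :
    R :=
  if (i < j)%N then width ab i else \1_(side ab i) (x ord0 i).

Let width_B_ge0 k i : 0 <= width (B k) i.
Proof. by rewrite subr_ge0; exact: B_cover.1. Qed.

Let partial_B_ge0 k j x i : 0 <= partial (B k) j x i.
Proof. by rewrite /partial; case: ifP. Qed.

(* Integrating the inequality [1 <= sum_k 1_(B k)], valid on [Q], in one
   coordinate after the other replaces each indicator by a width. *)
Let partial_integration j x : (j <= m)%N -> box Q x ->
  ((\prod_i partial Q j x i)%:E <=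
   \sum_(0 <= k <oo) (\prod_i partial (B k) j x i)%:E)%E.
Proof.
elim: j x => [|j IHj] x jm Qx.
  have prod1 ab : box ab x -> \prod_i partial ab 0 x i = 1.
    move=> abx; apply: big1 => i _; rewrite /partial/= indicE mem_set//.
    by rewrite /side/= in_itv/=; exact: abx.
  (* Some box of the cover contains [x], and its term alone equals 1. *)
  have [k _ Bkx] := B_cover.2 _ Qx.
  rewrite (prod1 _ Qx).
  rewrite (nneseriesD1 (n := k))//; last first.
    move=> i _; rewrite lee_fin; apply: prodr_ge0 => *; exact: partial_B_ge0.
  rewrite (prod1 _ Bkx) leeDl// nneseries_ge0// => i _ _.
  rewrite lee_fin; apply: prodr_ge0 => *; exact: partial_B_ge0.
pose j' := Ordinal jm; pose D := side Q j'.
(* These factors do not involve coordinate [j'], so they are constants in the integration below. *)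
pose rest ab := \prod_(i < m | i != j') partial ab j x i.
have rest_ge0 k : 0 <= rest (B k).
  by apply: prodr_ge0 => *; exact: partial_B_ge0.
have partialS ab : \prod_i partial ab j.+1 x i = width ab j' * rest ab.
  rewrite (bigD1 j')//= {1}/partial/= ltnSn; congr (_ * _).
  apply: eq_bigr => i ij; rewrite /partial ltnS leq_eqVlt.
  by rewrite -(inj_eq val_inj) in ij; rewrite (negPf ij).
have partial_set ab t : \prod_i partial ab j (rV_set x j' t) i =
    rest ab * \1_(side ab j') t.
  rewrite (bigD1 j')//= mulrC {2}/partial/= ltnn rV_setE eqxx; congr (_ * _).
  by apply: eq_bigr => i /negPf ij; rewrite /partial rV_setE ij.
have mD : measurable D by exact: measurable_itv.
have mside ab : measurable (side ab j') by exact: measurable_itv.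
(* The induction hypothesis is taken at [x] with coordinate [j'] moved to [t], which is still a
   point of [Q]. *)
have slice t : D t -> ((rest Q)%:E <=
    \sum_(0 <= k <oo) ((rest (B k))%:E * (\1_(side (B k) j') t)%:E))%E.
  move=> Dt; have := IHj (rV_set x j' t) (ltnW jm).
  rewrite partial_set indicE mem_set// mulr1.
  under eq_eseriesr do rewrite partial_set EFinM.
  apply => i; rewrite rV_setE; case: eqP => [->|_]; last exact: Qx.
  by move: Dt; rewrite /D /side/= in_itv.
have mu_side ab : box_ordered ab ->
    lebesgue_measure (side ab j') = (width ab j')%:E.
  move=> abj; rewrite /side lebesgue_measure_itv/= lte_fin.
  have := abj j'; rewrite le_eqVlt => /predU1P[e|->]; last by rewrite EFinB.
  by rewrite e ltxx /width e subrr.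
rewrite partialS; under eq_eseriesr do rewrite partialS.
have -> : (width Q j' * rest Q)%:E =
    (\int[@lebesgue_measure R]_(t in D) (rest Q)%:E)%E.
  rewrite integral_cst// EFinM muleC; congr (_ * _)%E; apply/esym.
  by apply: mu_side => i; exact/ltW.
pose f k (t : R) : \bar R := ((rest (B k))%:E * (\1_(side (B k) j') t)%:E)%E.
have mf k : measurable_fun D (f k).
  apply: emeasurable_funM => //.
  by apply/measurable_EFinP; exact: measurable_indic.
have f_ge0 k t : (0 <= f k t)%E.
  by rewrite mule_ge0// lee_fin.
have sum_ge0 t : (0 <= \sum_(0 <= k <oo) f k t)%E by exact: nneseries_ge0.
have rQ_ge0 : 0 <= rest Q.
  apply: prodr_ge0 => i _; rewrite /partial; case: ifP => // _.
  by rewrite subr_ge0; exact/ltW.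
apply: (@le_trans _ _ (\int[@lebesgue_measure R]_(t in D)
    \sum_(0 <= k <oo) f k t)%E).
  apply: ge0_le_integral => //.
  by apply: (@ge0_emeasurable_sum _ _ _ D f xpredT).
rewrite integral_nneseries//.
apply: lee_nneseries => [k _ _|k _]; first by apply: integral_ge0.
have m1 : measurable_fun D (fun t => (\1_(side (B k) j') t)%:E : \bar R).
  by apply/measurable_EFinP; exact: measurable_indic.
rewrite /f ge0_integralZl ?lee_fin//.
rewrite integral_indic//; last exact: mside.
rewrite mulrC EFinM lee_wpmul2l ?lee_fin//.
rewrite -mu_side; last exact: B_cover.1.
(* Only the part of the side inside [D] is integrated, and its measure is at most the width. *)
apply: le_measure; rewrite ?inE; last exact: subIsetl.
  by apply: measurableI => //; exact: mside.
exact: mside.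
Qed.

Lemma box_volume_le_cover :
  ((box_volume Q)%:E <= \sum_(0 <= k <oo) (box_volume (B k))%:E)%E.
Proof.
have volE ab : box_volume ab = \prod_i partial ab m Q.2 i.
  by apply: eq_bigr => i _; rewrite /partial ltn_ord.
rewrite volE; under eq_eseriesr do rewrite volE.
(* Boxes are closed above, so the corner [Q.2] is a point of [Q]; at stage [m] the product no longer
   depends on it. *)
by apply: partial_integration => // i; rewrite Q_lt lexx.
Qed.

End box_cover_volume.

Lemma lebesgue_rV_ge_box (R : realType) (m : nat) (Q : 'rV[R]_m * 'rV[R]_m)
    (A : set 'rV[R]_m) :
  (forall i, Q.1 ord0 i < Q.2 ord0 i) -> box Q `<=` A ->
  ((box_volume Q)%:E <= lebesgue_rV A)%E.
Proof.
move=> Q_lt QA; apply: le_ereal_inf_tmp => _ [B [B_le AB] <-].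
by apply: box_volume_le_cover => //; split=> //; exact: subset_trans AB.
Qed.

(** * The outer measure axioms, inherited from a content on boxes *)

Section lebesgue_outer_measure.
Context (R : realType) (m : nat).
Local Notation V := 'rV[R]_m.+1.
Implicit Types (ab cd : V * V) (A : set V).

Lemma lebesgue_rV_le_box ab A :
  box_ordered ab -> A `<=` box ab -> (lebesgue_rV A <= (box_volume ab)%:E)%E.
Proof.
move=> ab_le Aab; apply: ereal_inf_lbound.
(* The padding box [(0, 0)] has volume 0 because the dimension is positive. *)
exists (fun k => if k is 0%N return V * V then ab else (0, 0)).
  by split=> [[|k]//|x /Aab abx]; exists 0%N.
rewrite (nneseriesD1 (n := 0%N))//; last first.
  by move=> [|k] _; rewrite lee_fin box_volume_ge0.
rewrite eseries0 ?adde0// => -[|k] _ //= _.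
by rewrite /box_volume big_ord_recl/= subrr mul0r.
Qed.

(** If all sides of [ab] are positive, the outer measure of [box ab] lies between the two volumes;
    if one side is degenerate, the volume of [ab] is 0. *)
Lemma le_box_volume ab cd : box_ordered ab -> box_ordered cd ->
  box ab `<=` box cd -> box_volume ab <= box_volume cd.
Proof.
move=> ab_le cd_le abcd.
have [ab_lt|/existsNP[i /negP]] :=
    pselect (forall i, ab.1 ord0 i < ab.2 ord0 i).
  rewrite -lee_fin (le_trans (lebesgue_rV_ge_box ab_lt (@subset_refl _ _)))//.
  exact: lebesgue_rV_le_box.
rewrite -leNgt => abi; rewrite /box_volume (bigD1 i)//=.
have /eqP -> : ab.2 ord0 i - ab.1 ord0 i == 0.
  by rewrite subr_eq0 eq_le abi ab_le.
by rewrite mul0r box_volume_ge0.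
Qed.

(** Every set is measurable here, so [mu_ext] ranges over all countable covers. *)
Let discrete := g_sigma_algebraType [set: set V].

Let box_rep A := [set ab | box_ordered ab /\ A = box ab].

Let content A : \bar R :=
  if pselect (box_rep A !=set0) then (box_volume (xget (0, 0) (box_rep A)))%:E
  else +oo%E.

Let content_ge0 A : (0 <= content A)%E.
Proof.
rewrite /content; case: pselect => // -[ab abA].
by rewrite lee_fin box_volume_ge0//; case: (xgetPex (0, 0) (ex_intro _ _ abA)).
Qed.

(** Several corner pairs can describe the same set, as for the empty box. Monotonicity of the
    volume, used both ways, makes the choice of [xget] immaterial. *)
Let content_box ab : box_ordered ab -> content (box ab) = (box_volume ab)%:E.
Proof.
move=> ab_le; have rep : box_rep (box ab) ab by [].
rewrite /content; case: pselect => [e|[]]; last by exists ab.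
have [cd_le cdE] := xgetPex (0, 0) e.
by congr EFin; apply/eqP; rewrite eq_le !le_box_volume// -?cdE.
Qed.

Let content0 : content set0 = 0%E.
Proof.
have zero : box_ordered ((0, 0) : V * V) by move=> i.
have e : set0 = box ((0, 0) : V * V).
  apply/esym/seteqP; split=> // x /(_ ord0)/=.
  by move=> /andP[/lt_le_trans h /h]; rewrite ltxx.
by rewrite e content_box// /box_volume big_ord_recl subrr mul0r.
Qed.

(* [content] is the volume of a box and +oo on other sets, so that a cover by
   sets of finite content is a cover by boxes. *)
Let lebesgue_rVE :
  @lebesgue_rV R m.+1 = mu_ext (content : set discrete -> \bar R).
Proof.
apply/funext => A; apply/eqP; rewrite eq_le; apply/andP; split.
  apply: le_ereal_inf_tmp => _ [F [_ AF] <-].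
  have [F_box|/existsNP[k Fk]] := pselect (forall k, box_rep (F k) !=set0).
    apply: ereal_inf_lbound; exists (fun k => xget (0, 0) (box_rep (F k))).
      split=> [k|x /AF[k _ Fkx]]; first by have [] := xgetPex (0, 0) (F_box k).
      by exists k => //; have [_ <-] := xgetPex (0, 0) (F_box k).
    by apply: eq_eseriesr => k _; rewrite /content; case: pselect.
  rewrite (@eseries_pinfty _ _ xpredT k)// ?leey//.
    by move=> i _; rewrite gt_eqF// (lt_le_trans _ (content_ge0 _)).
  by rewrite /content; case: pselect.
apply: le_ereal_inf_tmp => _ [B [B_le AB] <-].
apply: ereal_inf_lbound; exists (fun k => box (B k)).
  by split=> // k; exact: sub_sigma_algebra.
by apply: eq_eseriesr => k _; rewrite content_box//; exact: B_le.
Qed.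

Let lebesgue_rV0 : lebesgue_rV (set0 : set V) = 0%E.
Proof. by rewrite lebesgue_rVE; exact: mu_ext0. Qed.

Let lebesgue_rV_ge0 A : (0 <= lebesgue_rV A)%E.
Proof. by rewrite lebesgue_rVE; exact: mu_ext_ge0. Qed.

Let le_lebesgue_rV :
  {homo (@lebesgue_rV R m.+1) : A B / A `<=` B >-> (A <= B)%E}.
Proof. by rewrite lebesgue_rVE => A B AB; exact: le_mu_ext. Qed.

Let lebesgue_rV_sigma_subadditive :
  sigma_subadditive (@lebesgue_rV R m.+1).
Proof.
rewrite lebesgue_rVE => F.
exact: (@mu_ext_sigma_subadditive _ discrete R content content_ge0 F).
Qed.

HB.instance Definition _ := isOuterMeasure.Build R V (@lebesgue_rV R m.+1)
  lebesgue_rV0 lebesgue_rV_ge0 le_lebesgue_rV lebesgue_rV_sigma_subadditive.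

End lebesgue_outer_measure.

(** * Measurability of coordinate half-spaces *)

Section halfspaces.
Context (R : realType) (m : nat).
Local Notation V := 'rV[R]_m.+1.
Local Notation mu := (@lebesgue_rV R m.+1).
Implicit Types (ab : V * V) (A U : set V).

(** The level [c] is clamped to the [i]-th side, here and in [cut_above], so that both pieces stay
    ordered when the hyperplane misses the box. *)
Let cut_below (i : 'I_m.+1) (c : R) ab : V * V :=
  (ab.1, rV_set ab.2 i (Num.max (ab.1 ord0 i) (Num.min (ab.2 ord0 i) c))).

Let cut_above (i : 'I_m.+1) (c : R) ab : V * V :=
  (rV_set ab.1 i (Num.min (ab.2 ord0 i) (Num.max (ab.1 ord0 i) c)), ab.2).

Let box_volume_cut i c ab : box_ordered ab ->
  box_volume (cut_below i c ab) + box_volume (cut_above i c ab) = box_volume ab.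
Proof.
move=> /(_ i) abi.
have volE cd : box_volume cd = (cd.2 ord0 i - cd.1 ord0 i) *
    \prod_(k < m.+1 | k != i) (cd.2 ord0 k - cd.1 ord0 k).
  by rewrite /box_volume (bigD1 i).
pose P := \prod_(k < m.+1 | k != i) (ab.2 ord0 k - ab.1 ord0 k).
rewrite !volE/= !rV_setE eqxx.
rewrite [X in _ * X + _](_ : _ = P); last first.
  by apply: eq_bigr => k /negPf ki; rewrite rV_setE ki.
rewrite [X in _ + _ * X](_ : _ = P); last first.
  by apply: eq_bigr => k /negPf ki; rewrite rV_setE ki.
rewrite -mulrDl; congr (_ * _).
move: abi; set a := ab.1 ord0 i; set b := ab.2 ord0 i => ab_le.
have [bc|cb] := leP b c.
  by rewrite (max_r (le_trans ab_le bc)) (min_l bc) (max_r ab_le) subrr addr0.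
have [ac|ca] := leP a c; first by rewrite (min_r (ltW cb)) addrC addrA subrK.
by rewrite (min_r ab_le) subrr add0r.
Qed.

Lemma caratheodory_halfspace (i : 'I_m.+1) (c : R) :
  mu.-caratheodory [set x : V | x ord0 i <= c].
Proof.
apply: le_caratheodory_measurable => X.
apply: le_ereal_inf_tmp => _ [B [B_le XB] <-].
have below_le k : box_ordered (cut_below i c (B k)).
  move=> j; rewrite /= rV_setE; case: eqP => [->|_]; last exact: B_le.
  by rewrite le_max lexx.
have above_le k : box_ordered (cut_above i c (B k)).
  move=> j; rewrite /= rV_setE; case: eqP => [->|_]; last exact: B_le.
  by rewrite ge_min lexx.
under eq_eseriesr do rewrite -(box_volume_cut i c) ?EFinD//.
rewrite nneseriesD; try by move=> k _ _; rewrite lee_fin box_volume_ge0.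
(* The lower pieces cover the part of [X] in the half-space, the upper pieces the rest. *)
apply: leeD; apply: ereal_inf_lbound.
  exists (fun k => cut_below i c (B k)) => //; split=> // x [/XB[k _ Bkx] xc].
  exists k => // j; rewrite /= rV_setE; case: eqP => [->|_]; last exact: Bkx.
  have /andP[-> xb] := Bkx i.
  by rewrite le_max le_min xb xc orbT.
exists (fun k => cut_above i c (B k)) => //; split=> // x [/XB[k _ Bkx] /negP].
rewrite -ltNge => xc; exists k => // j; rewrite /= rV_setE.
case: eqP => [->|_]; last exact: Bkx.
have /andP[xa ->] := Bkx i.
by rewrite gt_min gt_max xa xc orbT.
Qed.

End halfspaces.

(** * Null sets, and measurability from boxes to Jordan sets *)

Section lebesgue_jordan.
Context (R : realType) (m : nat).
Local Notation V := 'rV[R]_m.+1.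
Local Notation mu := (@lebesgue_rV R m.+1).
Implicit Types (ab : V * V) (A B N U : set V).

Lemma le_lebesgue_rV A B : A `<=` B -> (mu A <= mu B)%E.
Proof. exact: (@le_outer_measure R V mu). Qed.

Lemma lebesgue_rV_ge0 A : (0 <= mu A)%E.
Proof. exact: (@outer_measure_ge0 R V mu). Qed.

Lemma lebesgue_rVU_le A B : (mu (A `|` B) <= mu A + mu B)%E.
Proof. exact: (@outer_measureU2 V R mu). Qed.

Lemma null_subset A N : A `<=` N -> mu N = 0%E -> mu A = 0%E.
Proof.
move=> AN N0; apply/eqP; rewrite eq_le lebesgue_rV_ge0 andbT -N0.
exact: le_lebesgue_rV.
Qed.

Lemma caratheodory_null N : mu N = 0%E -> mu.-caratheodory N.
Proof.
move=> N0; apply: le_caratheodory_measurable => X /=.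
rewrite (null_subset (@subIsetr _ _ _) N0) add0e.
by apply: le_lebesgue_rV; exact: subIsetl.
Qed.

Lemma caratheodory_box ab : mu.-caratheodory (box ab).
Proof.
rewrite [box ab](_ : _ = \bigcap_i
    ([set x : V | x ord0 i <= ab.2 ord0 i] `\`
     [set x : V | x ord0 i <= ab.1 ord0 i])); last first.
  apply/seteqP; split=> [x abx i _|x abx i].
    by have /andP[ax xb] := abx i; split=> //=; apply/negP; rewrite -ltNge.
  by have [/= xb /negP] := abx i I; rewrite -ltNge => -> /=.
rewrite -[X in _.-caratheodory X]setCK setC_bigcap.
apply: caratheodory_measurable_setC.
apply: (@countable_bigcupT_measurable _ (caratheodory_type mu)) => // i.
by apply: caratheodory_measurable_setC; apply: caratheodory_measurable_setD;
  exact: caratheodory_halfspace.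
Qed.

(** Rational corners give a countable family, so an open set is a countable union of such boxes. *)
Let rat_box (q : 'rV[rat]_m.+1 * 'rV[rat]_m.+1) : V * V :=
  (map_mx ratr q.1, map_mx ratr q.2).

Let nbhs_rat_box (x : V) U : nbhs x U ->
  exists q, box (rat_box q) x /\ box (rat_box q) `<=` U.
Proof.
move=> /nbhs_ballP[e /= e_gt0 xeU].
have /choice[a aP] : forall i, exists a : rat,
    ratr a \in `](x ord0 i - e), (x ord0 i)[.
  by move=> i; apply: rat_in_itvoo; rewrite ltrBlDr ltrDl.
have /choice[b bP] : forall i, exists b : rat,
    ratr b \in `](x ord0 i), (x ord0 i + e)[.
  by move=> i; apply: rat_in_itvoo; rewrite ltrDl.
exists (\row_i a i, \row_i b i); split=> [i|y aby].
  have := aP i; have := bP i; rewrite /= !mxE !in_itv/=.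
  by move=> /andP[/ltW -> _] /andP[_ ->].
apply: xeU; split=> // i j; rewrite ord1 /ball/= distrC ltr_distl.
have := aP j; have := bP j; have := aby j; rewrite /= !mxE !in_itv/=.
move=> /andP[ay yb] /andP[_ be] /andP[ea _].
by rewrite (lt_trans ea ay) (le_lt_trans yb be).
Qed.

Lemma caratheodory_open U : open U -> mu.-caratheodory U.
Proof.
move=> oU; pose F q := if pselect (box (rat_box q) `<=` U) then box (rat_box q)
  else set0.
rewrite (_ : U = \bigcup_q F q).
  apply: (@countable_bigcupT_measurable _ (caratheodory_type mu)) => // q.
  rewrite /F; case: pselect => ? /=; first exact: caratheodory_box.
  exact: caratheodory_measurable_set0.
apply/seteqP; split=> [x Ux|x [q _]]; last first.
  by rewrite /F; case: pselect => // h /h.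
have [q [qx qU]] := nbhs_rat_box (open_nbhs_nbhs (conj oU Ux)).
by exists q => //; rewrite /F; case: pselect.
Qed.

(** A point of [U] lies in a rational box inside [U]; a half-open box containing a point has
    positive sides, hence positive measure. *)
Lemma open_null_eq0 U : open U -> mu U = 0%E -> U = set0.
Proof.
move=> oU U0; apply/seteqP; split=> // x Ux.
have [q [qx qU]] := nbhs_rat_box (open_nbhs_nbhs (conj oU Ux)).
have q_lt i : (rat_box q).1 ord0 i < (rat_box q).2 ord0 i.
  by have /andP[] := qx i; exact: lt_le_trans.
have := lebesgue_rV_ge_box q_lt qU; rewrite U0 lee_fin leNgt => /negP; apply.
by apply: prodr_gt0 => i _; rewrite subr_gt0.
Qed.

Lemma bounded_set_lebesgue_lty A : bounded_set A -> (mu A < +oo)%E.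
Proof.
(* [bounded_set] bounds the norm only by numbers strictly above [M]. *)
move=> [M [_ AM]]; pose c := M + 1.
have c_bound x : A x -> forall i, `|x ord0 i| <= c.
  move=> Ax i; apply: le_trans (AM c _ x Ax); last by rewrite ltrDl.
  rewrite [leRHS]/Num.norm/= mx_normrE.
  exact: (le_bigmax _ (fun ij => `|x ij.1 ij.2|) (ord0, i)).
have [->|/set0P[x0 Ax0]] := eqVneq A set0.
  by rewrite (@outer_measure0 R V mu).
have c_ge0 : 0 <= c by exact: le_trans (c_bound _ Ax0 ord0).
(* The lower corner is moved below [- c] because boxes are open below. *)
pose ab : V * V := (const_mx (- c - 1), const_mx c).
apply: (@le_lt_trans _ _ (box_volume ab)%:E); last exact: ltry.
apply: lebesgue_rV_le_box => [i|x Ax i]; rewrite !mxE.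
  by rewrite (@le_trans _ _ 0)// -opprD oppr_le0 addr_ge0.
have := c_bound _ Ax i; rewrite ler_norml => /andP[cx ->].
by rewrite andbT (lt_le_trans _ cx)// ltrBlDr ltrDl.
Qed.

Lemma null_bigcup (I : finType) (F : I -> set V) :
  (forall i, mu (F i) = 0%E) -> mu (\bigcup_i F i) = 0%E.
Proof.
move=> F0; have -> : \bigcup_i F i = \big[setU/set0]_i F i.
  by rewrite -bigcup_pred; congr bigcup; apply/seteqP; split.
elim/big_ind : _ => // A B A0 B0.
apply/eqP; rewrite eq_le lebesgue_rV_ge0 andbT.
by rewrite (le_trans (lebesgue_rVU_le _ _))// A0 B0 adde0.
Qed.

Lemma caratheodory_jordan A : jordan_measurable A -> mu.-caratheodory A.
Proof.
move=> [_ bd0]; have -> : A = A° `|` (A `\` A°).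
  by rewrite setDUK//; exact: interior_subset.
apply: caratheodory_measurable_setU.
  exact/caratheodory_open/open_interior.
apply: caratheodory_null; apply: null_subset bd0.
by apply: setSD; exact: subset_closure.
Qed.

End lebesgue_jordan.

(** * Regular Jordan sets *)

Lemma interior_boundaryPn (T : topologicalType) (A : set T) (x : T) :
  ~ boundary A x -> nbhs x A \/ nbhs x (~` A).
Proof.
move=> bdAx; have [Ax|Ax] := pselect (A° x); [by left|right].
have : (~` A)° x by rewrite interiorC => clAx; apply: bdAx.
by [].
Qed.

(** The hypothesis makes membership in [C] depend only on the pattern of memberships in the [A i].
    Off all their boundaries this finite pattern is locally constant, hence so is membership in
    [C]. *)
Lemma boundary_sub_bigcup (T : topologicalType) (I : finType) (A : I -> set T)
    (C : set T) :
  (forall x y, (forall i, A i x <-> A i y) -> C x -> C y) ->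
  boundary C `<=` \bigcup_i boundary (A i).
Proof.
move=> CA x [clCx intCx]; apply: contrapT => bdAx.
have same : \forall y \near x, forall i, A i x <-> A i y.
  apply: filter_forall => i.
  have : ~ boundary (A i) x by move=> bdi; apply: bdAx; exists i.
  move=> /interior_boundaryPn[] Ai; have Aix := nbhs_singleton Ai;
    by apply: filterS Ai => y Aiy; split.
have [Cx|Cx] := pselect (C x).
  by apply: intCx; apply: filterS same => y xy; exact: CA xy Cx.
have : (~` C)° x.
  by apply: filterS same => y xy Cy; apply: Cx; apply: CA Cy => i; rewrite xy.
by rewrite interiorC; exact.
Qed.

Lemma bounded_set_subset (R : realType) (V : normedModType R) (A B : set V) :
  A `<=` B -> bounded_set B -> bounded_set A.
Proof.
by move=> AB [M [Mr BM]]; exists M; split=> // c /BM Bc x /AB; exact: Bc.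
Qed.

Lemma bounded_set_bigcup (R : realType) (V : normedModType R) (I : finType)
    (A : I -> set V) :
  (forall i, bounded_set (A i)) -> bounded_set (\bigcup_i A i).
Proof.
move=> bA; have : \forall M \near +oo, forall i,
    globally (A i) [set x | `|x| <= M] by exact: filter_forall.
rewrite /= /bounded_near.
by apply: filterS => M AM x [i _ Aix]; exact: AM Aix.
Qed.

(** * Rigidity up to null sets, finite unions and additivity *)

Section regular_jordan_sets.
Context (R : realType) (m : nat).
Local Notation V := 'rV[R]_m.+1.
Local Notation mu := (@lebesgue_rV R m.+1).
Implicit Types (A C D F P U : set V).

Lemma regular_jordan_closed P : regular_jordan P -> closed P.
Proof. by move=> [[_ ->] _]; exact: closed_closure. Qed.

Lemma closure_open_sub_closed U F :
  open U -> closed F -> mu (U `\` F) = 0%E -> closure U `<=` F.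
Proof.
move=> oU cF UF0; have : U `\` F = set0.
  apply: open_null_eq0 UF0; rewrite setDE; apply: openI => //.
  exact: closed_openC.
rewrite setD_eq0 => UF.
by apply: subset_trans (closure_subset UF) _; rewrite -(closure_id F).1.
Qed.

Lemma regular_sub_closed P F :
  regular_jordan P -> closed F -> mu (P `\` F) = 0%E -> P `<=` F.
Proof.
move=> [[_ Pci] _] cF PF0; rewrite Pci; apply: closure_open_sub_closed => //.
  exact: open_interior.
by apply: null_subset PF0; apply: setSD; exact: interior_subset.
Qed.

Lemma regular_null_eq0 P : regular_jordan P -> mu P = 0%E -> P = set0.
Proof.
move=> rP P0; apply/seteqP; split=> //; apply: regular_sub_closed => //.
  exact: closed0.
by rewrite setD0.
Qed.

(** Serves for every bounded Boolean combination of finitely many Jordan sets, such as unions and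
    partition cells. *)
Lemma jordan_measurable_determined (I : finType) (A : I -> set V) C :
  (forall x y, (forall i, A i x <-> A i y) -> C x -> C y) ->
  (forall i, jordan_measurable (A i)) -> bounded_set C -> jordan_measurable C.
Proof.
move=> CA jA bC; split=> //.
apply: null_subset (boundary_sub_bigcup CA) _.
by apply: null_bigcup => i; exact: (jA i).2.
Qed.

Lemma regular_jordan_bigcup (I : finType) (P : I -> set V) :
  (forall i, regular_jordan (P i)) -> regular_jordan (\bigcup_i P i).
Proof.
move=> rP; have bP : bounded_set (\bigcup_i P i).
  by apply: bounded_set_bigcup => i; exact: (rP i).1.1.
have cP : closed (\bigcup_i P i).
  apply: closed_bigcup => [|i _]; first exact: finite_finset.
  exact: regular_jordan_closed.
split; last first.
  apply: jordan_measurable_determined bP => [x y xy [i _ Pix]|i].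
    by exists i => //; apply/xy.
  exact: (rP i).2.
split=> //; apply/seteqP; split=> [x [i _]|]; last first.
  by apply: subset_trans cP; apply: closure_subset; exact: interior_subset.
(* Each [P i] is the closure of its interior, which lies in the interior of the union. *)
rewrite (rP i).1.2; apply: closure_subset; apply: interiorS.
exact: bigcup_sup.
Qed.

(** Splitting [D] along [C] shows that the intersection has measure [mu D = mu C]; splitting [C]
    along [D] and cancelling this finite value leaves 0. *)
Lemma null_setD_sym C D :
  mu.-caratheodory C -> mu.-caratheodory D -> (mu C < +oo)%E ->
  mu D = mu C -> mu (D `\` C) = 0%E -> mu (C `\` D) = 0%E.
Proof.
move=> mC mD C_fin DC DC0; have CD := mD C; have := mC D.
rewrite -!setDE DC0 adde0 DC setIC => CI.
rewrite -setDE -CI addeC in CD.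
have C_fin_num : mu C \is a fin_num by rewrite ge0_fin_numE// lebesgue_rV_ge0.
by rewrite -[LHS](addeK (mu (C `\` D)) C_fin_num) -CD subee.
Qed.

Lemma lebesgue_rV_bigcup (I : finType) (F : I -> set V) :
  (forall i, mu.-caratheodory (F i)) -> trivIset setT F ->
  mu (\bigcup_i F i) = (\sum_i mu (F i))%E.
Proof.
move=> mF tF.
pose mu' : {outer_measure set V -> \bar R} := mu.
(* By Caratheodory's theorem, the outer measure is a measure on its measurable sets. *)
pose nu : {measure set (caratheodory_type mu') -> \bar R} :=
  (mu' : set (caratheodory_type mu') -> \bar R).
transitivity (\sum_(i \in [set: I]) mu (F i))%E.
  exact: (@measure_fin_bigcup _ _ _ nu I setT F finite_finset tF
    (fun i _ => mF i)).
rewrite -big_enum/= [RHS]fsbig_seq ?enum_uniq//.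
by apply: eq_fsbigl; apply/seteqP; split=> // i _; rewrite /= mem_enum.
Qed.

End regular_jordan_sets.

(** * Partition averages *)

Lemma partition_cellP (T : Type) (n : nat) (A : 'I_n.+1 -> set T)
    (X : {set 'I_n.+1}) (x : T) :
  partition_cell A X x <-> X != finset.set0 /\ (forall i, A i x <-> i \in X).
Proof.
rewrite /partition_cell; case: (eqVneq X finset.set0) => [_|X0].
  by split=> [//|[]].
split=> [[inA notA]|[_ AX]].
  split=> // i; split=> [Aix|]; last exact: inA.
  by apply: contrapT => /negP Xi; apply: notA; exists i.
split=> [i Xi|[i Xi]]; first exact/AX.
by move=> /AX; rewrite (negPf Xi).
Qed.

Lemma partition_cell_disjoint (T : Type) (n : nat) (A : 'I_n.+1 -> set T)
    (X Y : {set 'I_n.+1}) (x : T) :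
  partition_cell A X x -> partition_cell A Y x -> X = Y.
Proof.
move=> /partition_cellP[_ AX] /partition_cellP[_ AY].
by apply/setP => i; apply/idP/idP => [/AX/AY|/AY/AX].
Qed.

Lemma partition_cell_self (T : Type) (n : nat) (A : 'I_n.+1 -> set T) (x : T)
    (i : 'I_n.+1) :
  A i x -> partition_cell A [set j | `[< A j x >]]%SET x.
Proof.
move=> Aix; apply/partition_cellP; split=> [|j]; last first.
  by rewrite inE; split=> /asboolP.
by apply/finset.set0Pn; exists i; rewrite inE; exact/asboolP.
Qed.

Lemma sum_weights01 (R : numDomainType) (I : finType) (alpha : I -> R)
    (X : {set I}) :
  (forall i, 0 <= alpha i) -> \sum_i alpha i = 1 ->
  0 <= \sum_(i in X) alpha i <= 1.
Proof.
move=> alpha_ge0 alpha_sum; rewrite sumr_ge0//= -alpha_sum.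
by rewrite [leRHS](bigID (mem X))/= lerDl sumr_ge0.
Qed.

Lemma exists_pos_weight (R : realDomainType) (I : finType) (alpha : I -> R) :
  (forall i, 0 <= alpha i) -> \sum_i alpha i = 1 -> exists i, 0 < alpha i.
Proof.
move=> alpha_ge0 alpha_sum; apply: contrapT => no_pos.
move: alpha_sum; rewrite big1 => [/eqP|i _]; first by rewrite eq_sym oner_eq0.
apply/eqP; rewrite eq_le alpha_ge0 andbT leNgt; apply/negP => ai.
by apply: no_pos; exists i.
Qed.

Section partition_average_properties.
Context (R : realType) (m : nat).
Local Notation V := 'rV[R]_m.+1.
Local Notation mu := (@lebesgue_rV R m.+1).
Variable Psi : set V -> R -> set V.
Hypothesis HPsi : subset_generating Psi.

Lemma subset_generating_set0 (t : R) : 0 <= t <= 1 -> Psi set0 t = set0.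
Proof.
move=> t01; have j0 : jordan_measurable (set0 : set V).
  (* The empty set is a combination of no sets at all, whence the index type [void]. *)
  apply: (@jordan_measurable_determined _ _ void (fun=> set0)) => //.
  by exists 0; split=> // c _ x.
apply: regular_null_eq0; first exact: (sg_regular_jordan HPsi).
by rewrite (sg_measure HPsi)// (@outer_measure0 R V mu) mule0.
Qed.

(** * Regularity, bounds and measure of a single average *)

Section fixed_weights.
Context (n : nat) (A : 'I_n.+1 -> set V) (alpha : 'I_n.+1 -> R).
Hypothesis HA : forall i, regular_jordan (A i).
Hypothesis alpha_ge0 : forall i, 0 <= alpha i.
Hypothesis alpha_sum : \sum_i alpha i = 1.
Local Notation weight X := (\sum_(k < n.+1 | k \in X) alpha k).
Local Notation cell X := (partition_cell A X).
Local Notation average := (partition_average Psi alpha A).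

Let weight01 (X : {set 'I_n.+1}) : 0 <= weight X <= 1.
Proof. exact: sum_weights01. Qed.

Let cell_jordan X : jordan_measurable (cell X).
Proof.
apply: (@jordan_measurable_determined _ _ _ A) => [x y xy|i|].
- move=> /partition_cellP[X0 AX]; apply/partition_cellP; split=> // i.
  by rewrite -AX xy.
- exact: (HA i).2.
(* A nonempty [X] places the cell inside some [A i]. The convention for the empty index set excludes
   the unbounded complement of the union. *)
- apply: bounded_set_subset (bounded_set_bigcup (fun i => (HA i).1.1)).
  move=> x /partition_cellP[/finset.set0Pn[i Xi] AX].
  by exists i => //; apply/AX.
Qed.

Let cell_regular X : regular_jordan (Psi (cell X) (weight X)).
Proof. exact: (sg_regular_jordan HPsi). Qed.

Let cell_caratheodory X : mu.-caratheodory (cell X).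
Proof. exact: caratheodory_jordan. Qed.

Let Psi_caratheodory X : mu.-caratheodory (Psi (cell X) (weight X)).
Proof. exact/caratheodory_jordan/(cell_regular X).2. Qed.

Lemma partition_average_regular_jordan : regular_jordan average.
Proof. exact: regular_jordan_bigcup. Qed.

(** A point common to all [A i] of positive weight lies in a cell of total weight 1, and there [Psi]
    fills the cell up to a null set. The points missed thus lie in a finite union of null sets. *)
Lemma ci_bigcap_sub_partition_average :
  ci (\bigcap_(i in [set i | 0 < alpha i]) A i) `<=` average.
Proof.
apply: closure_open_sub_closed; first exact: open_interior.
  exact: regular_jordan_closed partition_average_regular_jordan.
pose N (X : {set _}) :=
  if weight X == 1 then cell X `\` Psi (cell X) (weight X) else set0.
apply: (@null_subset _ _ _ (\bigcup_X N X)); last first.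
  apply: null_bigcup => X; rewrite /N; case: eqP => [X1|_]; last first.
    exact: (@outer_measure0 R V mu).
  apply: null_setD_sym => //.
  - exact/bounded_set_lebesgue_lty/(cell_jordan X).1.
  - by rewrite (sg_measure HPsi)// X1 mul1e.
  - exact: (sg_sub_null HPsi).
move=> x [/interior_subset Ax notx].
have [i alpha_i] := exists_pos_weight alpha_ge0 alpha_sum.
pose X := [set j | `[< A j x >]]%SET.
have Xx : cell X x by apply: (partition_cell_self (i := i)); exact: Ax.
(* An index outside [X] has weight 0, since [x] lies in every [A j] of positive weight. *)
have X1 : weight X = 1.
  rewrite -alpha_sum [RHS](bigID (mem X))/= [X in _ + X]big1 ?addr0// => j.
  rewrite inE => /asboolP Ajx; apply/eqP; rewrite eq_le alpha_ge0 andbT leNgt.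
  by apply/negP => /Ax.
exists X => //; rewrite /N X1 eqxx; split=> // Psix; apply: notx.
by exists X; rewrite ?X1.
Qed.

(** If [X] contains an index [i] of positive weight, its piece lies in the closed set [A i] up to a
    null set, hence entirely; otherwise the piece has measure 0 and is empty. *)
Lemma partition_average_sub_bigcup :
  average `<=` \bigcup_(i in [set i | 0 < alpha i]) A i.
Proof.
move=> x [X _]; have [[i [Xi ai]]|no_pos] :=
    pselect (exists i, i \in X /\ 0 < alpha i).
  move=> PsiXx; exists i => //.
  apply: regular_sub_closed PsiXx => //; first exact: regular_jordan_closed.
  apply: null_subset (sg_sub_null HPsi (cell_jordan X) (weight01 X)).
  apply: setDS => y /partition_cellP[_ AX]; exact/AX.
rewrite (@regular_null_eq0 _ _ (Psi _ _))// (sg_measure HPsi)// big1 ?mul0e//.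
move=> i Xi; apply/eqP; rewrite eq_le alpha_ge0 andbT leNgt; apply/negP => ai.
by apply: no_pos; exists i.
Qed.

(** The pieces [P X] may overlap, so each is intersected with its own cell: the cells are disjoint
    and only null sets are lost. *)
Lemma lebesgue_partition_average :
  mu average = (\sum_i (alpha i)%:E * mu (A i))%E.
Proof.
pose P (X : {set _}) := Psi (cell X) (weight X).
have PC0 X : mu (P X `\` cell X) = 0%E by exact: (sg_sub_null HPsi).
have mPC X : mu.-caratheodory (P X `&` cell X).
  by apply: caratheodory_measurable_setI;
    [exact: Psi_caratheodory|exact: cell_caratheodory].
have tPC : trivIset setT (fun X => P X `&` cell X).
  by move=> X Y _ _ [x [[_ Xx] [_ Yx]]]; exact: partition_cell_disjoint Xx Yx.
have muP X : mu (P X `&` cell X) = mu (P X).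
  have /= -> := cell_caratheodory X (P X).
  by rewrite -setDE PC0 adde0.
have -> : mu average = mu (\bigcup_X (P X `&` cell X)).
  apply/eqP; rewrite eq_le; apply/andP; split; last first.
    by apply: le_lebesgue_rV => x [X _ [PXx _]]; exists X.
  apply: (@le_trans _ _ (mu (\bigcup_X (P X `&` cell X)) +
      mu (\bigcup_X (P X `\` cell X)))%E).
    rewrite (le_trans _ (lebesgue_rVU_le _ _))//; apply: le_lebesgue_rV.
    move=> x [X _ PXx]; have [Xx|Xx] := pselect (cell X x).
      by left; exists X.
    by right; exists X.
  by rewrite (null_bigcup PC0) adde0.
rewrite lebesgue_rV_bigcup//.
(* [A i] is the disjoint union of the cells whose index set contains [i]; the formula then follows
   by exchanging the sums over [X] and [i]. *)
have muA i : mu (A i) = (\sum_(X : {set 'I_n.+1} | i \in X) mu (cell X))%E.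
  rewrite big_mkcond/=.
  have -> : A i = \bigcup_(X : {set _}) (if i \in X then cell X else set0).
    apply/seteqP; split=> [x Aix|x [X _]].
      exists [set j | `[< A j x >]]%SET => //.
      by rewrite inE asboolT//; exact: partition_cell_self Aix.
    by case: ifPn => // Xi /partition_cellP[_ AX]; exact/AX.
  rewrite lebesgue_rV_bigcup.
  - apply: eq_bigr => X _; case: ifP => // _;
      exact: (@outer_measure0 R V mu).
  - by move=> X; case: ifP => // _; exact: caratheodory_measurable_set0.
  - move=> X Y _ _ [x []]; case: ifP => // _ Xx; case: ifP => // _ Yx.
    exact: partition_cell_disjoint Xx Yx.
have muPE X : mu (P X) =
    (\sum_i if i \in X then (alpha i)%:E * mu (cell X) else 0)%E.
  rewrite (sg_measure HPsi)// -sumEFin ge0_sume_distrl; last first.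
    by move=> i _; rewrite lee_fin.
  by rewrite big_mkcond.
under eq_bigr => X _ do rewrite muP muPE.
rewrite exchange_big/=; apply: eq_bigr => i _.
rewrite muA ge0_sume_distrr; last by move=> X _; exact: lebesgue_rV_ge0.
by rewrite [RHS]big_mkcond.
Qed.

End fixed_weights.

(* Pushing the weights along a surjection [f] covers both permutations and the
   merging of equal sets: the cells of [A \o f] at index sets that are not
   unions of fibers of [f] are empty, and [Psi] is empty there. *)
Lemma partition_average_push (n k : nat) (f : 'I_n.+1 -> 'I_k.+1)
    (A : 'I_k.+1 -> set V) (alpha : 'I_n.+1 -> R) :
  (forall j, exists i, f i = j) ->
  (forall i, 0 <= alpha i) -> \sum_i alpha i = 1 ->
  partition_average Psi alpha (A \o f) =
  partition_average Psi (fun j => \sum_(i | f i == j) alpha i) A.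
Proof.
move=> f_surj alpha_ge0 alpha_sum.
have cell_preim (Y : {set 'I_k.+1}) :
    partition_cell (A \o f) (f @^-1: Y)%SET = partition_cell A Y.
  (* Surjectivity keeps the preimage of a nonempty index set nonempty. *)
  have Y0 : (f @^-1: Y == finset.set0)%SET = (Y == finset.set0).
    apply/eqP/eqP => [e|->]; last by rewrite preimset0.
    apply/setP => j; have [i <-] := f_surj j.
    by have /setP/(_ i) := e; rewrite !inE.
  apply/seteqP; split=> x /partition_cellP[X0 AX]; apply/partition_cellP.
    split=> [|j]; first by rewrite -Y0.
    by have [i <-] := f_surj j; have := AX i; rewrite inE.
  by split=> [|i]; [rewrite Y0|rewrite inE; exact: AX].
have weight_preim (Y : {set 'I_k.+1}) :
    \sum_(i in (f @^-1: Y)%SET) alpha i =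
    \sum_(j in Y) \sum_(i | f i == j) alpha i.
  rewrite (partition_big f (mem Y))/= => [|i]; last by rewrite inE.
  apply: eq_bigr => j Yj; apply: eq_bigl => i; rewrite inE.
  by case: eqP => [->|]; rewrite ?Yj ?andbF.
apply/seteqP; split=> x [X _ PsiXx]; last first.
  by exists (f @^-1: X)%SET => //; rewrite cell_preim weight_preim.
exists (f @: X)%SET => //.
suff eX : (f @^-1: (f @: X))%SET = X.
  by rewrite -cell_preim -weight_preim eX.
(* A point [y] of the cell would force [X] to be a union of fibers, because membership of [y] in
   [A (f i)] depends on [f i] only. *)
apply: contrapT => /eqP nX; have cell0 : partition_cell (A \o f) X = set0.
  apply/seteqP; split=> // y /partition_cellP[_ AX]; apply: (negP nX).
  apply/eqP/setP => i; rewrite inE; apply/imsetP/idP => [[j Xj fij]|Xi].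
    by apply/AX; rewrite /= fij; apply/AX.
  by exists i.
by move: PsiXx; rewrite cell0 subset_generating_set0//; exact: sum_weights01.
Qed.

End partition_average_properties.

Theorem theorem3p8 (R : realType) (m : nat) (m_gt0 : (0 < m)%N)
    (Psi : set 'rV[R]_m -> R -> set 'rV[R]_m) (HPsi : subset_generating Psi)
    (n : nat) (A : 'I_n.+1 -> set 'rV[R]_m) (alpha : 'I_n.+1 -> R)
    (HA : forall i, regular_jordan (A i))
    (alpha01 : forall i, 0 <= alpha i <= 1)
    (alpha_sum : \sum_(i < n.+1) alpha i = 1) :
  (* 1 *)
  regular_jordan (partition_average Psi alpha A) /\
  (* 2 *)
  (forall r : 'S_n.+1,
    partition_average Psi alpha A =
    partition_average Psi (fun i => alpha (r i)) (fun i => A (r i))) /\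
  (* 3 *)
  (forall k : 'I_n.+1, (1 <= k)%N ->
    (forall i : 'I_n.+1, (k <= i)%N -> A i = A k) ->
    forall beta : 'I_k.+1 -> R,
      (forall i : 'I_k.+1, (i < k)%N ->
        beta i = alpha (widen_ord (ltn_ord k) i)) ->
      beta ord_max = \sum_(j < n.+1 | (k <= j)%N) alpha j ->
      partition_average Psi alpha A =
      partition_average Psi beta (fun i => A (widen_ord (ltn_ord k) i))) /\
  (forall B : set 'rV[R]_m, regular_jordan B ->
    partition_average Psi alpha (fun _ : 'I_n.+1 => B) = B) /\
  (* 4 *)
  (ci (\bigcap_(i in [set i | 0 < alpha i]) A i) `<=`
     partition_average Psi alpha A /\
   partition_average Psi alpha A `<=`
     \bigcup_(i in [set i | 0 < alpha i]) A i) /\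
  (* 5 *)
  (forall j : 'I_n.+1, alpha j = 1 -> partition_average Psi alpha A = A j) /\
  (* 6 *)
  lebesgue_rV (partition_average Psi alpha A) =
    (\sum_(i < n.+1) (alpha i)%:E * lebesgue_rV (A i))%E.

Proof.
case: m m_gt0 Psi HPsi A HA => [//|m'] _ {}Psi {}HPsi {}A {}HA.
have alpha_ge0 i : 0 <= alpha i by have /andP[] := alpha01 i.
have [j0 alpha_j0] := exists_pos_weight alpha_ge0 alpha_sum.
(* When all sets of positive weight equal [B], the two bounds of property 4 become [ci B] and [B],
   which coincide. This gives the average of a constant family and property 5. *)
have const_average (A' : 'I_n.+1 -> set 'rV[R]_m'.+1) (B : set 'rV[R]_m'.+1) :
    (forall i, regular_jordan (A' i)) -> regular_jordan B ->
    (forall i, 0 < alpha i -> A' i = B) -> partition_average Psi alpha A' = B.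
  move=> HA' [[_ Bci] _] A'B; apply/seteqP; split.
    move=> x /(partition_average_sub_bigcup HPsi HA' alpha_ge0 alpha_sum).
    by move=> [i /= ai]; rewrite A'B.
  apply: subset_trans
    (ci_bigcap_sub_partition_average HPsi HA' alpha_ge0 alpha_sum).
  rewrite {1}Bci; apply: closure_subset; apply: interiorS => x Bx i /= ai.
  by rewrite A'B.
split; first exact: partition_average_regular_jordan.
split.
  (* The weights are pushed along the inverse of [r], whose fiber over [j] is the single index
     [r j]. *)
  move=> r; have eA : A = (fun i => A (r i)) \o (r^-1)%g.
    by apply/funext => i /=; rewrite permKV.
  rewrite {1}eA partition_average_push//; last first.
    by move=> j; exists (r j); rewrite permK.
  congr (partition_average Psi _ _); apply/funext => j.
  by rewrite (big_pred1 (r j))// => i; rewrite (can2_eq (permKV r) (permK r)).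
split.
  move=> k _ Ak beta beta_lt beta_max.
  (* [f] collapses all indices from [k] on to [k]: the fiber over [k] carries the summed weight, and
     every other fiber is a single index. *)
  pose f (i : 'I_n.+1) : 'I_k.+1 := inord (minn i k).
  have fE i : f i = minn i k :> nat by rewrite inordK// ltnS geq_minr.
  have eA : A = (fun i => A (widen_ord (ltn_ord k) i)) \o f.
    apply/funext => i /=; have [ik|ki] := ltnP i k.
      by congr (A _); apply/val_inj; rewrite /= fE (minn_idPl (ltnW ik)).
    rewrite (Ak i)// [RHS]Ak//= fE; exact: (eq_leq (esym (minn_idPr ki))).
  rewrite {1}eA partition_average_push//; last first.
    move=> j; exists (widen_ord (ltn_ord k) j); apply/val_inj; rewrite /= fE.
    apply/minn_idPl. exact: leq_ord.
  congr (partition_average Psi _ _); apply/funext => j.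
  have [jk|kj] := ltnP j k.
    rewrite beta_lt// (big_pred1 (widen_ord (ltn_ord k) j))// => i.
    rewrite /= -!(inj_eq val_inj)/= fE.
    have [ik|ki] := ltnP i k => //.
    by rewrite (gtn_eqF jk) (gtn_eqF (leq_trans jk ki)).
  have -> : j = ord_max by apply/val_inj/eqP; rewrite eqn_leq kj -ltnS ltn_ord.
  rewrite beta_max; apply: eq_bigl => i; rewrite -(inj_eq val_inj)/= fE.
  by apply/eqP/idP => /minn_idPr.
split; first by move=> B rB; exact: const_average.
split.
  by split; [exact: ci_bigcap_sub_partition_average
            |exact: partition_average_sub_bigcup].
split; last exact: lebesgue_partition_average.
move=> j aj; apply: const_average => // i ai; congr A.
(* The weights other than [alpha j = 1] are nonnegative with sum 0, so a positive weight at some [i]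
   different from [j] is impossible. *)
apply: contrapT => /eqP ij.
move: alpha_sum; rewrite (bigD1 j)//= aj -[RHS]addr0 => /addrI/eqP.
rewrite psumr_eq0//.
by move=> /allP/(_ i); rewrite mem_index_enum ij (gt_eqF ai)/= => /(_ isT).
Qed.
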